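(* Let $H$ and $X$ be separable Hilbert spaces and let $g\colon X\to\mathbb{R}$, $r\colon H\to\mathbb{R}$ and $h\colon X\times H\to\mathbb{R}$ satisfy the following assumptions. (A1) $g$ is convex, and both $g$ and $r$ are bounded below. (A2) $\nabla_x h$ and $\nabla_x^2 h$ are continuous in $b$, and there exist a constant $\mu^*>0$ and constants $\mu(b),L(b)$ with $0<\mu^*\le\mu(b)\le L(b)$ for all $b\in H$, such that $\mu(b)I\preceq\nabla_x^2h(x,b)\preceq L(b)I$ for all $x\in X$, $b\in H$. (A3) $g$ and $r$ are continuously differentiable with Lipschitz continuous gradients, with Lipschitz constants $L_{\nabla g}$ and $L_{\nabla r}$, respectively. Suppose in addition that the sub-level sets of $r$ are strongly compact in $H$. Consider the bilevel problem $$\min_{b\in H}\{g(\hat x(b))+r(b)\}\quad\text{s.t.}\quad \hat x(b):=\arg\min_{x\in X}h(x,b),$$ and let $(b_k)_{k\ge0}$ be the iterates of the Method of Adaptive Inexact Descent (MAID, described in the context) applied to it, with accuracies $\epsilon_k,\delta_k$ and step sizes $\alpha_k$ chosen adaptively so that the inexact sufficient decrease condition $\psi(\alpha_k)\le0$ holds at every iteration $k$. Let $\tilde x(b_k)$ be the corresponding inexact lower-level solutions, and let $b^*\in H$ be the stationary point of $b\mapsto g(\hat x(b))+r(b)$ to which $(b_k)$ converges strongly in $H$. Then $\tilde x(b_k)$ converges strongly in $X$ to $\hat x(b^* )$, the solution of the limiting lower-level problem.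
   Context: Notation: $\nabla_x h$, $\nabla_x^2h$ denote the first and second derivatives of $h$ in its first argument, $\nabla^2_{xb}h$ the mixed second derivative, and $A\preceq B$ the usual order on self-adjoint operators. By (A2) the lower-level objective $h(\cdot,b)$ is strongly convex, so $\hat x(b)$ is well defined. Under these assumptions it is a known result that the MAID iterates converge strongly to a stationary point $b^*$; the statement refers to this limit $b^*$. Inexact hypergradient. Given $b\in H$ and accuracies $\epsilon,\delta>0$, InexactGradient$(b,\epsilon,\delta)$ does the following: (1) find $\tilde x(b)\in X$ with $\|\nabla_xh(\tilde x(b),b)\|\le\epsilon\,\mu(b)$; (2) solve the linear system $\nabla_x^2h(\tilde x(b),b)q=\nabla g(\tilde x(b))$ for $q$ with residual $\delta$; (3) return $z=-(\nabla^2_{xb}h(\tilde x(b),b))^Tq+\nabla r(b)$. Sufficient decrease condition. Fix $\lambda>0$. Put $\ell(x,b):=g(x)+r(b)$, let $L_{\nabla_x\ell}$ be the Lipschitz constant of $\nabla_x\ell$ in $x$ (so $L_{\nabla_x\ell}=L_{\nabla g}$), $u_k:=(\tilde x(b_k),b_k)$ and $\bar\epsilon_{k+1}:=\max\{\epsilon_k,\epsilon_{k+1}\}$, where $\epsilon_k$ is the accuracy with which $\tilde x(b_k)$ is computed, and $b_{k+1}=b_k-\alpha_kz_k$. Define $$\psi(\alpha_k):=\ell(u_{k+1})+\|\nabla_x\ell(u_{k+1})\|\bar\epsilon_{k+1}+\frac{L_{\nabla_x\ell}}{2}\bar\epsilon_{k+1}^2-\ell(u_k)+\|\nabla_x\ell(u_k)\|\bar\epsilon_{k+1}+\lambda\alpha_k\|z_k\|^2.$$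 MAID. Hyperparameters: $\underline\rho,\underline\nu\in(0,1)$, $\overline\rho,\overline\nu>1$, $\max_{BT}\in\mathbb{N}$. Input: $b_0\in H$, accuracies $\epsilon_0,\delta_0>0$, step size $\alpha_0>0$. For $k=0,1,\dots$: - For $j=\max_{BT},\max_{BT}+1,\dots$: compute $z_k$ by InexactGradient$(b_k,\epsilon_k,\delta_k)$. For $i=0,\dots,j-1$: if $\psi(\alpha_k)\le0$, leave both loops (backtracking successful); otherwise replace $\alpha_k$ by $\underline\rho\,\alpha_k$. If no $i$ succeeds, replace $(\epsilon_k,\delta_k)$ by $(\underline\nu\epsilon_k,\underline\nu\delta_k)$ and continue with the next $j$. - Set $b_{k+1}=b_k-\alpha_kz_k$, and initialize $\epsilon_{k+1}=\overline\nu\epsilon_k$, $\delta_{k+1}=\overline\nu\delta_k$, $\alpha_{k+1}=\overline\rho\alpha_k$.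
   Formalization: The Lipschitz constant of ∇g is taken positive; for constant g with constant 0 the claim fails, since ψ ignores the accuracies. ψ(α_k)≤0 is read with the same x̃(b_{k+1}) and ε_{k+1} with which iteration k+1 ends. *)

(* Defs.v *)
From HB Require Import structures.
From mathcomp Require Import all_boot all_order all_algebra sesquilinear.
From mathcomp Require Import all_classical all_reals all_analysis.

Set Implicit Arguments.
Unset Strict Implicit.
Unset Printing Implicit Defensive.

Import Order.TTheory GRing.Theory Num.Theory.
Import numFieldNormedType.Exports.

Local Open Scope classical_set_scope.
Local Open Scope ring_scope.

HB.mixin Record isHilbert (R : realType) V of CompleteNormedModule R V := {
  inner : {dot V for @idfun R} ;
  inner_norm : forall x : V, inner x x = `|x| ^+ 2
}.

#[short(type="hilbertType")]
HB.structure Definition Hilbert (R : realType) :=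
  {V of isHilbert R V & CompleteNormedModule R V}.

Definition separable_space (T : topologicalType) : Prop :=
  exists2 D : set T, countable D & dense D.

Section Calculus.
Context {R : realType} {V W : hilbertType R}.

(* The Riesz representative of the Frechet derivative of f at x; the default
   value 0 is never reached when f is differentiable at x. *)
Definition grad (f : V -> R^o) (x : V) : V :=
  xget 0 [set u | forall v, inner u v = 'd f x v].

Definition adjoint (A : V -> W) (w : W) : V :=
  xget 0 [set u | forall v, inner u v = inner w (A v)].

(* Loewner order. Second derivatives are automatically self-adjoint, so that
   comparing quadratic forms is all there is to it. *)
Definition loewner_le (A B : V -> V) : Prop :=
  forall v, inner (A v) v <= inner (B v) v.

(* Continuity for the operator norm of a family of bounded operators. *)
Definition op_continuous (T : topologicalType) (A : T -> V -> W) : Prop :=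
  forall t0 (e : R), 0 < e ->
    \forall t \near t0, forall v, `|A t v - A t0 v| <= e * `|v|.

Definition minimizers (f : V -> R) : set V := [set x | forall y, f x <= f y].

Definition argmin (f : V -> R) : V := xget 0 (minimizers f).

Definition stationary (f : V -> R^o) (x : V) : Prop :=
  differentiable f x /\ grad f x = 0.

(* A Lipschitz constant is any positive number for which the estimate holds; the
   best constant qualifies unless grad f is constant. *)
Definition C1_lipschitz_grad (f : V -> R^o) (L : R) : Prop :=
  [/\ forall x, differentiable f x, continuous (grad f),
      0 < L & L.-lipschitz (grad f)].

End Calculus.

Section Bilevel.
Context {R : realType} {X H : hilbertType R}.
Variables (g : X -> R^o) (r : H -> R^o) (h : X -> H -> R^o).

Definition grad_x (x : X) (b : H) : X := grad (h ^~ b) x.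

Definition hess_xx (x : X) (b : H) : X -> X := 'd (grad_x ^~ b) x.

Definition hess_xb (x : X) (b : H) : H -> X := 'd (grad_x x) b.

Definition xhat (b : H) : X := argmin (h ^~ b).

Definition reduced_objective (b : H) : R^o := g (xhat b) + r b.

Definition ell (x : X) (b : H) : R^o := g x + r b.

Definition inexact_solution (mu : H -> R) (b : H) (eps : R) (x : X) : Prop :=
  `|grad_x x b| <= eps * mu b.

(* InexactGradient may return z, with lower-level solution x. *)
Definition inexact_gradient (mu : H -> R) (b : H) (eps delta : R)
    (x : X) (z : H) : Prop :=
  inexact_solution mu b eps x /\
  exists2 q : X, `|hess_xx x b q - grad g x| <= delta
               & z = - adjoint (hess_xb x b) q + grad r b.

Definition psi (L lambda : R) (b : H) (x : X) (eps : R) (z : H) (alpha : R)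
    (x' : X) (eps' : R) : R :=
  let b' := b - alpha *: z in
  let ebar := Num.max eps eps' in
  ell x' b' + `|grad (ell ^~ b') x'| * ebar + L / 2 * ebar ^+ 2
  - ell x b + `|grad (ell ^~ b) x| * ebar + lambda * alpha * `|z| ^+ 2.

End Bilevel.

Record maid_param (R : realType) := MaidParam {
  lambda : R ;
  rho_dn : R ;
  rho_up : R ;
  nu_dn : R ;
  nu_up : R ;
  maxBT : nat ;
  lambda_gt0 : 0 < lambda ;
  rho_dn01 : 0 < rho_dn < 1 ;
  nu_dn01 : 0 < nu_dn < 1 ;
  rho_up_gt1 : 1 < rho_up ;
  nu_up_gt1 : 1 < nu_up
}.

Section Maid.
Context {R : realType} {X H : hilbertType R}.
Variables (p : maid_param R) (g : X -> R^o) (r : H -> R^o) (h : X -> H -> R^o).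
Variables (mu : H -> R) (L : R).

(* The accuracy eps' of the lower-level solution x' at a trial point that is
   discarded is left free. *)
Definition rejected (b : H) (x : X) (eps : R) (z : H) (alpha : R) : Prop :=
  exists x' eps', [/\ 0 < eps',
    inexact_solution h mu (b - alpha *: z) eps' x' &
    0 < psi g r L (lambda p) b x eps z alpha x' eps'].

(* maid_search b j eps delta alpha x z eps' delta' alpha': started at round j
   with accuracies (eps, delta) and step size alpha, the two nested loops at b
   are left with the lower-level solution x, the direction z and the current
   values eps', delta', alpha'. That the test succeeds at alpha' is part of
   maid_run, since it involves the next iterate. *)
Inductive maid_search (b : H) :
    nat -> R -> R -> R -> X -> H -> R -> R -> R -> Prop :=
| search_success j eps delta alpha x z i of
    inexact_gradient g r h mu b eps delta x z &
    (i < j)%N &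
    (forall l, (l < i)%N -> rejected b x eps z (rho_dn p ^+ l * alpha)) :
    maid_search b j eps delta alpha x z eps delta (rho_dn p ^+ i * alpha)
| search_refine j eps delta alpha x0 z0 x z eps' delta' alpha' of
    inexact_gradient g r h mu b eps delta x0 z0 &
    (forall l, (l < j)%N -> rejected b x0 eps z0 (rho_dn p ^+ l * alpha)) &
    maid_search b j.+1 (nu_dn p * eps) (nu_dn p * delta)
      (rho_dn p ^+ j * alpha) x z eps' delta' alpha' :
    maid_search b j eps delta alpha x z eps' delta' alpha'.

(* eps k, delta k, alpha k, x k, z k are the values with which iteration k is
   left; in particular x k.+1 and eps k.+1 are the lower-level solution and the
   accuracy that both the test of iteration k and that of iteration k.+1 use. *)
Record maid_run (eps0 delta0 alpha0 : R) (b : nat -> H) (x : nat -> X)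
    (z : nat -> H) (eps delta alpha : nat -> R) : Prop := MaidRun {
  maid_start :
    maid_search (b 0%N) (maxBT p) eps0 delta0 alpha0
      (x 0%N) (z 0%N) (eps 0%N) (delta 0%N) (alpha 0%N) ;
  maid_next : forall k,
    maid_search (b k.+1) (maxBT p)
      (nu_up p * eps k) (nu_up p * delta k) (rho_up p * alpha k)
      (x k.+1) (z k.+1) (eps k.+1) (delta k.+1) (alpha k.+1) ;
  maid_step : forall k, b k.+1 = b k - alpha k *: z k ;
  maid_decrease : forall k,
    psi g r L (lambda p) (b k) (x k) (eps k) (z k) (alpha k)
      (x k.+1) (eps k.+1) <= 0
}.

End Maid.

(* Main.v *)
(** Summing the sufficient decrease inequalities, whose remaining terms are
    nonnegative, bounds [Lg / 2 * \sum_(k > 0) eps_k ^ 2] by the gap between [ell (u_0)] and a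
    lower bound of [g + r]; hence [eps_k --> 0].  The lower bound on the Hessian
    makes [grad_x h] strongly monotone in its first argument, so that, with
    [xs := xhat bstar],
    [mu(b_k) |xs - x_k| <= eps_k mu(b_k) + |grad_x h xs b_k|],
    and the last term tends to [|grad_x h xs bstar| = 0].  Both the existence of
    [xs] and the Riesz representation behind [grad] come from one fact: a
    minimizing sequence of a function that is strongly convex at midpoints is
    Cauchy. *)
Require Import Defs.
From HB Require Import structures.
From mathcomp Require Import all_boot all_order all_algebra.
From mathcomp Require Import all_classical all_reals all_analysis.
From mathcomp Require Import sesquilinear ring lra.
Import Order.TTheory GRing.Theory Num.Theory.
Import numFieldNormedType.Exports.
Local Open Scope classical_set_scope.
Local Open Scope ring_scope.

(** * Inner product identities and the Cauchy-Schwarz inequality *)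

Section Hilbert.
Context {R : realType} {V : hilbertType R}.
Implicit Types u v w : V.

Lemma innerC u v : inner u v = inner v u.
Proof. by rewrite hermC expr0 mul1r. Qed.

Lemma innerZl a u v : inner (a *: u) v = a * inner u v.
Proof. exact: linearZl_LR. Qed.

Lemma innerZr a u v : inner u (a *: v) = a * inner u v.
Proof. by rewrite innerC innerZl innerC. Qed.

Lemma innerDl u v w : inner (u + v) w = inner u w + inner v w.
Proof. exact: linearDl. Qed.

Lemma innerDr u v w : inner u (v + w) = inner u v + inner u w.
Proof. exact: linearDr. Qed.

Lemma innerBl u v w : inner (u - v) w = inner u w - inner v w.
Proof. exact: linearBl. Qed.

Lemma sqr_normD u v :
  `|u + v| ^+ 2 = `|u| ^+ 2 + 2 * inner u v + `|v| ^+ 2.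
Proof.
by rewrite -!inner_norm innerDl !innerDr (innerC v u); ring.
Qed.

Lemma sqr_normB u v :
  `|u - v| ^+ 2 = `|u| ^+ 2 - 2 * inner u v + `|v| ^+ 2.
Proof. by rewrite sqr_normD -scaleN1r innerZr normrZ normrN normr1; ring. Qed.

Lemma inner_le_norm u v : inner u v <= `|u| * `|v|.
Proof.
have [->|u0] := eqVneq u 0; first by rewrite linear0l normr0 mul0r.
have [->|v0] := eqVneq v 0; first by rewrite linear0r normr0 mulr0.
(* Scaling both vectors to the same length makes the square equal to [2 |u| |v|] times the
   Cauchy-Schwarz defect [|u| |v| - inner u v]. *)
have : 0 <= `| `|v| *: u + (- `|u|) *: v| ^+ 2 by exact: sqr_ge0.
rewrite sqr_normD innerZl innerZr !normrZ normrN !normr_id.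
rewrite [leRHS](_ : _ = 2 * (`|u| * `|v|) * (`|u| * `|v| - inner u v));
  last by ring.
by rewrite pmulr_rge0 ?subr_ge0// !mulr_gt0 ?normr_gt0.
Qed.

Lemma normr_inner u v : `|inner u v| <= `|u| * `|v|.
Proof.
rewrite ler_norml inner_le_norm andbT lerNl -linearNl.
by rewrite (le_trans (inner_le_norm _ _)) ?normrN.
Qed.

Lemma cvg_innerl {T : Type} {F : set_system T} {FF : Filter F}
    (f : T -> V) (l w : V) :
  f @ F --> l -> inner (f t) w @[t --> F] --> inner l w.
Proof.
move=> fl; apply/cvgrPdist_le => e e0.
have w0 : 0 < `|w| + 1 by rewrite ltr_wpDl.
have /cvgrPdist_le/(_ (e / (`|w| + 1))) := fl.
move=> /(_ (divr_gt0 e0 w0)); apply: filterS => t ft.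
rewrite -innerBl (le_trans (normr_inner _ _))//.
rewrite -[leRHS](divfK (lt0r_neq0 w0)) ler_pM// lerDl//.
Qed.

End Hilbert.

(** * Minimizing sequences and Riesz representation *)

Lemma midpoint_convex_minimizer {R : realType} {V : completeNormedModType R}
    (f : V -> R) (c : R) :
  continuous f -> has_lbound (range f) -> 0 < c ->
  (forall x y, f (2^-1 *: (x + y)) + c * `|x - y| ^+ 2 <= (f x + f y) / 2) ->
  exists x, forall y, f x <= f y.
Proof.
move=> cf lbf c0 conv.
have rinf : has_inf (range f) by split => //; exists (f 0), 0.
set m := inf (range f).
have mle y : m <= f y by apply: ge_inf => //; exists y.
have /choice[x xP] (n : nat) : exists y, f y < m + harmonic n.
  by have [_ [y _ <-] ?] := inf_adherent (harmonic_gt0 n) rinf; exists y.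
(* At the midpoint [f] is still at least [m], so only the excesses of [f (x n)] and [f (x k)] over
   [m] are left to bound the distance. *)
have xdist n k : c * `|x n - x k| ^+ 2 <= (harmonic n + harmonic k) / 2.
  have := conv (x n) (x k); have := mle (2^-1 *: (x n + x k)).
  have := xP n; have := xP k; lra.
have /cvg_ex[/= l xl] : cvgn x.
  apply/cauchy_cvgP/cauchy_ballP => e e0.
  have ce : 0 < c * e ^+ 2 by rewrite mulr_gt0 ?exprn_gt0.
  have hN := cvgr0_norm_lt _ (@cvg_harmonic R) _ ce.
  pose N := [set n | `|harmonic n| < c * e ^+ 2].
  rewrite near_simpl /=; exists (N, N); first by split; exact: hN.
  move=> [n k] /= [hn hk]; rewrite -ball_normE /=.
  rewrite -(@ltr_pXn2r _ 2%N)// ?nnegrE ?(ltW e0)// -(ltr_pM2l c0).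
  apply: le_lt_trans (xdist n k) _.
  have : harmonic n < c * e ^+ 2 by exact: le_lt_trans (ler_norm _) hn.
  have : harmonic k < c * e ^+ 2 by exact: le_lt_trans (ler_norm _) hk.
  by lra.
exists l => y; apply: le_trans _ (mle y).
have fx : f (x n) @[n --> \oo] --> f l.
  by apply: cvg_comp xl _; exact: cf.
have mx : m + harmonic n @[n --> \oo] --> m.
  rewrite -[X in _ --> X]addr0.
  by apply: cvgD; [exact: cvg_cst|exact: cvg_harmonic].
by apply: ler_cvg_to fx mx _; apply: nearW => n; exact/ltW.
Qed.

(** For small [t] of sign opposite to [d] the linear term would win. This is the first-order
    condition at a minimizer of a quadratic functional. *)
Lemma linear_le_quadratic0 {R : realFieldType} (d s : R) :
  (forall t, 0 <= t * d + t ^+ 2 * s) -> d = 0.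
Proof.
move=> ds; have s0 : 0 <= s by have := ds 1; have := ds (-1); nra.
have s1 : 0 < s + 1 by rewrite ltr_wpDl.
(* At this [t] the expression equals [- (d / (s + 1)) ^+ 2]; the added 1 keeps the denominator
   positive when [s = 0]. *)
have := ds (- d / (s + 1)).
have -> : - d / (s + 1) * d + (- d / (s + 1)) ^+ 2 * s =
  - (d / (s + 1)) ^+ 2 by field; rewrite lt0r_neq0.
rewrite oppr_ge0 => dn; have := sqr_ge0 (d / (s + 1)) => dp.
have /eqP : (d / (s + 1)) ^+ 2 = 0 by apply/eqP; rewrite eq_le dn dp.
by rewrite sqrf_eq0 mulf_eq0 invr_eq0 (gt_eqF s1) orbF => /eqP.
Qed.

Section Riesz.
Context {R : realType} {V : hilbertType R}.

(** The representative is the minimizer of the energy [|x|^2 / 2 - f x], whose first variation at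
    [u] along [v] is [inner u v - f v]. *)
Lemma riesz (f : {linear V -> R^o}) : continuous f ->
  exists u : V, forall v, inner u v = f v.
Proof.
move=> cf; pose F (x : V) : R := `|x| ^+ 2 / 2 - f x.
have [k k0 fk] := linear_lipschitz cf.
(* By the parallelogram law the midpoint convexity gap of [F] is exactly [|x - y|^2 / 8]. *)
have [|||x y|u uF] := @midpoint_convex_minimizer R V F 8^-1.
- move=> x; apply: cvgB; last exact: cf.
  by apply: cvgM; [apply: cvgM; exact: norm_continuous|exact: cvg_cst].
(* The minimum over [s] of [s^2 / 2 - k s], where [k] is a Lipschitz constant of [f]. *)
- exists (- (k ^+ 2 / 2)) => _ [x _ <-]; rewrite /F.
  have := le_trans (ler_norm _) (fk x); have := sqr_ge0 (`|x| - k); nra.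
- by [].
- have fE : f (2^-1 *: (x + y)) = 2^-1 * (f x + f y) by rewrite linearZ linearD.
  rewrite /F fE normrZ exprMn sqr_normB sqr_normD.
  by rewrite ger0_norm ?invr_ge0//; lra.
exists u => v; apply/eqP; rewrite -subr_eq0; apply/eqP.
apply: (@linear_le_quadratic0 R _ (`|v| ^+ 2 / 2)) => t.
have fE : f (u + t *: v) = f u + t * f v by rewrite linearD linearZ.
have := uF (u + t *: v); rewrite /F fE sqr_normD innerZr normrZ.
rewrite exprMn real_normK ?num_real//; lra.
Qed.

End Riesz.

(** * Calculus along segments *)

Lemma derive_ge_increment {R : realType} (phi dphi : R -> R) (c : R) :
  (forall t : R, is_derive t 1 phi (dphi t)) ->
  (forall t, 0 < t < 1 -> c <= dphi t) -> c <= phi 1 - phi 0.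
Proof.
move=> dphiP dphi_ge.
have [t t01 ->] : exists2 t, t \in `]0, 1[ & phi 1 - phi 0 = dphi t * (1 - 0).
  apply: MVT => //; apply: derivable_within_continuous => t _.
  exact: ex_derive.
by rewrite subr0 mulr1; apply: dphi_ge; move: t01; rewrite in_itv.
Qed.

Lemma is_derive_line {R : realType} {V W : normedModType R} (G : V -> W)
    (y v : V) (t : R) : differentiable G (y + t *: v) ->
  is_derive t 1 (fun s : R => G (y + s *: v)) ('d G (y + t *: v) v).
Proof.
move=> dG.
have dl : is_diff t (cst y + *:%R ^~ v : R -> V) (0 + *:%R ^~ v : R -> V).
  exact: is_diffD.
have dGl : is_diff t (G \o (cst y + *:%R ^~ v))
    ('d G (y + t *: v) \o (0 + *:%R ^~ v)).
  by apply: is_diff_comp; exact: DiffDef.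
apply: DeriveDef; first by apply: diff_derivable; exact: ex_diff.
rewrite deriveE; last exact: ex_diff.
by rewrite diff_val /= add0r scale1r.
Qed.

(** * Gradients, strong monotonicity and strong convexity *)

Section Gradient.
Context {R : realType} {V : hilbertType R}.

Lemma is_derive_innerl (F : R -> V) (t : R) (dF w : V) :
  is_derive t 1 F dF ->
  is_derive t 1 (fun s => inner (F s) w) (inner dF w).
Proof.
move=> [dF1 dF2].
suff : h^-1 *: (inner (F (h *: (1 : R) + t)) w - inner (F t) w) @[h --> 0^'] -->
    inner dF w.
  by move=> H; apply: DeriveDef; [exact: cvgP H|exact: cvg_lim].
have : h^-1 *: (F (h *: (1 : R) + t) - F t) @[h --> 0^'] --> dF.
  by rewrite -dF2.
move/(cvg_innerl _ _ w); apply: cvg_trans; apply: near_eq_cvg.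
by apply: nearW => h; rewrite innerZl innerBl.
Qed.

(** By [riesz] the set from which [grad] chooses is nonempty, so the default 0 is not taken. *)
Lemma inner_grad (f : V -> R^o) (x v : V) :
  differentiable f x -> inner (grad f x) v = 'd f x v.
Proof.
move=> df; have [u uP] := @riesz R V ('d f x) (diff_continuous df).
by have := xgetPex 0 (ex_intro (fun u => forall v, inner u v = 'd f x v) u uP).
Qed.

Lemma grad_minimizer (f : V -> R^o) (x : V) :
  (forall y, differentiable f y) -> minimizers f x -> grad f x = 0.
Proof.
move=> df fx; apply/eqP; rewrite -normr_eq0 -sqrf_eq0 -inner_norm inner_grad//.
(* Along the gradient itself the directional derivative is [|grad f x|^2], and it vanishes because 0
   minimizes [f] on this line. *)
set v := grad f x; apply/eqP.
have dphi (t : R) := @is_derive_line R V R^o f x v t (df _).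
have := dphi 0; rewrite scale0r addr0 => dphi0.
have phi0 : is_derive (0 : R) 1 (fun s : R => f (x + s *: v)) 0.
  apply: (@derive1_at_min R _ (-1) 1) => [|t _||t _].
  - by lra.
  - exact: ex_derive.
  - by rewrite in_itv /= ltrN10 ltr01.
  - by rewrite scale0r addr0; exact: fx.
by rewrite -(@derive_val _ _ _ _ _ _ _ dphi0) derive_val.
Qed.

(** The map [t |-> inner (G (y + t v)) v] on the segment from [y] to [x] has derivative at least
    [m |v|^2]. *)
Lemma strongly_monotone (G : V -> V) (m : R) :
  (forall x, differentiable G x) ->
  (forall x v, m * `|v| ^+ 2 <= inner ('d G x v) v) ->
  forall x y, m * `|x - y| ^+ 2 <= inner (G x - G y) (x - y).
Proof.
move=> dG Gm x y; set v := x - y.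
have -> : inner (G x - G y) v =
    inner (G (y + 1 *: v)) v - inner (G (y + 0 *: v)) v.
  by rewrite scale1r scale0r addr0 subrKC innerBl.
apply: (@derive_ge_increment _ (fun t => inner (G (y + t *: v)) v)
  (fun t => inner ('d G (y + t *: v) v) v)) => // t.
by apply: is_derive_innerl; exact: is_derive_line.
Qed.

(** Subtracting the affine and quadratic parts from [f] on the segment leaves [phi], whose
    derivative is nonnegative by monotonicity between [x + t v] and [x]. *)
Lemma strongly_convex_lower_bound (f : V -> R^o) (m : R) :
  (forall x, differentiable f x) ->
  (forall x y, m * `|x - y| ^+ 2 <= inner (grad f x - grad f y) (x - y)) ->
  forall x v, f x + inner (grad f x) v + m / 2 * `|v| ^+ 2 <= f (x + v).
Proof.
move=> df fm x v; pose a : R := inner (grad f x) v.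
pose s : R := m / 2 * `|v| ^+ 2.
pose phi (t : R) : R := f (x + t *: v) - (a * t + s * (t * t)).
have : 0 <= phi 1 - phi 0.
  apply: (@derive_ge_increment _ phi (fun t => inner (grad f (x + t *: v)) v -
      (a + 2 * t * s))) => t.
    apply: is_deriveB.
      by rewrite inner_grad//; exact: is_derive_line.
    have dq : is_derive t 1 (a \*: id + s \*: (id * id) : R -> R)
        (a + 2 * t * s).
      apply: is_derive_eq; rewrite /GRing.scale /=; move: (s) (a).
      by move=> ? ?; ring.
    exact: dq.
  (* Monotonicity carries a factor [t] on both sides; it cancels since the mean value theorem only
     asks for [0 < t < 1]. *)
  move=> /andP[t0 _].
  have fmt := fm (x + t *: v) x.
  rewrite addrAC subrr add0r normrZ innerZr innerBl exprMn in fmt.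
  rewrite real_normK ?num_real// -/a in fmt.
  have tE : m * (t ^+ 2 * `|v| ^+ 2) = t * (2 * t * s).
    by rewrite /s; move: (`|v|) => n; field.
  by rewrite tE (ler_pM2l t0) in fmt; rewrite subr_ge0 -lerBrDl.
rewrite /phi scale1r scale0r addr0 /s /a; lra.
Qed.

(** Existence comes from midpoint convexity, uniqueness from the quadratic lower bound at a
    minimizer, where the gradient vanishes. Hence [argmin] returns an actual minimizer rather than
    its default. *)
Lemma strongly_convex_minimizers (f : V -> R^o) (m : R) :
  0 < m -> (forall x, differentiable f x) ->
  (forall x y, m * `|x - y| ^+ 2 <= inner (grad f x - grad f y) (x - y)) ->
  minimizers f = [set argmin f].
Proof.
move=> m0 df fm; have lb := strongly_convex_lower_bound f m df fm.
(* Averaging the lower bounds at the midpoint in the directions [w] and [- w], with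
   [w = (x - y) / 2], gives the gap [m / 2 |w|^2 = m / 8 |x - y|^2]. *)
have [|||x y|u uf] := @midpoint_convex_minimizer R V f (m / 8).
- by move=> x; exact: differentiable_continuous.
- exists (f 0 - `|grad f 0| ^+ 2 / (2 * m)) => _ [x _ <-].
  have := lb 0 x; rewrite add0r; apply: le_trans.
  have := normr_inner (grad f 0) x; rewrite ler_norml => /andP[gx _].
  (* Completing the square in [|x|] absorbs the linear term of the lower bound at 0. *)
  have : 0 <= (`|grad f 0| - m * `|x|) ^+ 2 / (2 * m).
    by rewrite divr_ge0 ?sqr_ge0// ltW// mulr_gt0.
  have -> : (`|grad f 0| - m * `|x|) ^+ 2 / (2 * m) = `|grad f 0| ^+ 2 / (2 * m)
     - `|grad f 0| * `|x| + m / 2 * `|x| ^+ 2 by field; rewrite lt0r_neq0.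
  lra.
- lra.
- have half (t : V) : 2^-1 *: (t + t) = t.
    have h1 : 2^-1 + 2^-1 = 1 :> R by field.
    by rewrite scalerDr -scalerDl h1 scale1r.
  set w := 2^-1 *: (x - y); set z := 2^-1 *: (x + y).
  have -> : f x = f (z + w).
    by congr f; rewrite /z /w -scalerDr addrACA subrr addr0 half.
  have -> : f y = f (z - w).
    by congr f; rewrite /z /w -scalerBr opprB (addrC x) addrACA subrr addr0
      half.
  have := lb z w; have := lb z (- w).
  have -> : `|x - y| ^+ 2 = 4 * `|w| ^+ 2.
    by rewrite normrZ exprMn ger0_norm ?invr_ge0//; field.
  by rewrite normrN -scaleN1r innerZr; lra.
have min1 x : minimizers f x -> x = u.
  move=> fx; have := lb u (x - u); rewrite grad_minimizer// linear0l addr0.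
  rewrite subrKC => ux.
  have xu : m / 2 * `|x - u| ^+ 2 <= 0 by have := fx u; lra.
  apply/eqP; rewrite -subr_eq0 -normr_eq0 -sqrf_eq0 eq_le sqr_ge0 andbT.
  by rewrite -(@pmulr_rle0 _ (m / 2))// divr_gt0.
have argminu : argmin f = u.
  by apply: min1; exact: (xgetPex 0 (ex_intro _ u uf)).
rewrite argminu; apply/seteqP; split => x /=; first exact: min1.
by move=> ->.
Qed.

End Gradient.

(** * Accuracies along a run of MAID *)

Section MaidRun.
Context {R : realType} {X H : hilbertType R}.
Context {p : maid_param R} {g : X -> R^o} {r : H -> R^o} {h : X -> H -> R^o}.
Context {mu : H -> R} {L : R}.

Lemma maid_search_inexact (b : H) j eps delta alpha x z eps' delta' alpha' :
  maid_search p g r h mu L b j eps delta alpha x z eps' delta' alpha' ->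
  inexact_solution h mu b eps' x.
Proof. by elim=> // {}j {}eps {}delta {}alpha {}x {}z i []. Qed.

Lemma maid_search_step_gt0 (b : H) j eps delta alpha x z eps' delta' alpha' :
  maid_search p g r h mu L b j eps delta alpha x z eps' delta' alpha' ->
  0 < alpha -> 0 < alpha'.
Proof.
have /andP[rho0 _] := rho_dn01 p.
elim=> [? ? ? ? ? ? ? _ _ _ ?|? ? ? ? ? ? ? ? ? ? ? _ _ _ IH ?].
  by rewrite mulr_gt0 ?exprn_gt0.
by apply: IH; rewrite mulr_gt0 ?exprn_gt0.
Qed.

Context {eps0 delta0 alpha0 : R} {b : nat -> H} {x : nat -> X} {z : nat -> H}.
Context {eps delta alpha : nat -> R}.
Hypothesis run : maid_run p g r h mu L eps0 delta0 alpha0 b x z eps delta alpha.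

Lemma maid_run_inexact k : inexact_solution h mu (b k) (eps k) (x k).
Proof.
case: k => [|k].
  exact: maid_search_inexact (maid_start run).
exact: maid_search_inexact (maid_next run k).
Qed.

Lemma maid_run_step_gt0 k : 0 < alpha0 -> 0 < alpha k.
Proof.
move=> a0; elim: k => [|k IH].
  exact: maid_search_step_gt0 (maid_start run) a0.
apply: maid_search_step_gt0 (maid_next run k) _.
by rewrite mulr_gt0// (lt_trans ltr01)// rho_up_gt1.
Qed.

(** The sign is read off the residual test: [eps k * mu (b k)] bounds a norm. *)
Lemma maid_run_accuracy_ge0 k : (forall c, 0 < mu c) -> 0 <= eps k.
Proof.
move=> mu0; rewrite -(pmulr_lge0 _ (mu0 (b k))).
exact: le_trans (normr_ge0 _) (maid_run_inexact k).
Qed.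

Lemma maid_run_ell_decrease k : 0 <= L -> 0 < alpha0 -> (forall c, 0 < mu c) ->
  L / 2 * eps k.+1 ^+ 2 <=
    ell g r (x k) (b k) - ell g r (x k.+1) (b k.+1).
Proof.
have aux (u v n1 n2 n3 c c' : R) : 0 <= n1 -> 0 <= n2 -> 0 <= n3 -> c <= c' ->
  u + n1 + c' - v + n2 + n3 <= 0 -> c <= v - u by lra.
move=> L0 a0 mu0; have := maid_decrease run k; rewrite /psi -(maid_step run k).
set e := Num.max _ _.
(* The test uses the larger of two consecutive accuracies, so it controls the accuracy at [k.+1]. *)
have e1 : eps k.+1 <= e by rewrite le_max lexx orbT.
have ek := maid_run_accuracy_ge0 k.+1 mu0.
have e0 : 0 <= e := le_trans ek e1.
have esq : L / 2 * eps k.+1 ^+ 2 <= L / 2 * e ^+ 2.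
  by rewrite ler_wpM2l ?divr_ge0// ler_sqr.
have n1 := mulr_ge0 (normr_ge0 (grad (ell g r ^~ (b k.+1)) (x k.+1))) e0.
have n2 := mulr_ge0 (normr_ge0 (grad (ell g r ^~ (b k)) (x k))) e0.
have n3 : 0 <= lambda p * alpha k * `|z k| ^+ 2.
  by rewrite !mulr_ge0// ltW ?lambda_gt0// maid_run_step_gt0.
exact: aux n1 n2 n3 esq.
Qed.

(** The objective values [E k] decrease and are bounded below, so they converge; their consecutive
    gaps, which dominate [L / 2 * eps k.+1 ^+ 2], then tend to 0. *)
Lemma maid_run_accuracy_cvg0 : 0 < L -> 0 < alpha0 -> (forall c, 0 < mu c) ->
  has_lbound (range g) -> has_lbound (range r) -> eps @ \oo --> (0 : R).
Proof.
move=> L0 a0 mu0 [mg gm] [mr rm].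
pose E k : R := ell g r (x k) (b k).
have Edec k := maid_run_ell_decrease k (ltW L0) a0 mu0.
have E_nincr : nonincreasing_seq E.
  apply/nonincreasing_seqP => k; rewrite -subr_ge0; apply: le_trans (Edec k).
  by rewrite mulr_ge0 ?sqr_ge0// divr_ge0// ltW.
have /(nonincreasing_cvgn E_nincr) El : has_lbound (range E).
  exists (mg + mr) => _ [k _ <-]; apply: lerD; first by apply: gm; exists (x k).
  by apply: rm; exists (b k).
have dE : E k - E k.+1 @[k --> \oo] --> (0 : R).
  rewrite -[X in _ --> X](subrr (inf (range E))).
  by apply: cvgB => //; rewrite (cvg_shiftS E).
rewrite -(cvg_shiftS eps); apply/cvgr0Pnorm_le => e e0.
have le0 : 0 < L / 2 * e ^+ 2 by rewrite mulr_gt0 ?divr_gt0 ?exprn_gt0.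
move/cvgr0Pnorm_le : dE => /(_ _ le0); apply: filterS => k Ek.
have ek := maid_run_accuracy_ge0 k.+1 mu0.
rewrite ger0_norm// -(@ler_pXn2r _ 2%N) ?nnegrE ?(ltW e0)//.
have L2 : 0 < L / 2 by rewrite divr_gt0.
rewrite -(ler_pM2l L2); apply: le_trans (Edec k) _.
exact: le_trans (ler_norm _) Ek.
Qed.

End MaidRun.

(** * Convergence of the inexact lower-level solutions *)

Theorem corollary1 (R : realType) (X H : hilbertType R)
    (g : X -> R^o) (r : H -> R^o) (h : X -> H -> R^o)
    (mustar : R) (mu Lh : H -> R) (Lg Lr : R)
    (p : maid_param R) (eps0 delta0 alpha0 : R)
    (b : nat -> H) (x : nat -> X) (z : nat -> H)
    (eps delta alpha : nat -> R) (bstar : H) :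
  separable_space X -> separable_space H ->
  (* (A1) *)
  convex_function [set: X] g ->
  has_lbound (range g) -> has_lbound (range r) ->
  (* (A2) *)
  (forall x b, differentiable (h ^~ b) x) ->
  (forall x b, differentiable (grad_x h ^~ b) x) ->
  (forall x b, differentiable (grad_x h x) b) ->
  (forall x, continuous (grad_x h x)) ->
  (forall x, op_continuous (hess_xx h x)) ->
  0 < mustar ->
  (forall b, mustar <= mu b <= Lh b) ->
  (forall x b, loewner_le (fun v => mu b *: v) (hess_xx h x b)) ->
  (forall x b, loewner_le (hess_xx h x b) (fun v => Lh b *: v)) ->
  (* (A3) *)
  C1_lipschitz_grad g Lg -> C1_lipschitz_grad r Lr ->
  (forall c : R, compact [set b | r b <= c]) ->
  0 < eps0 -> 0 < delta0 -> 0 < alpha0 ->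
  maid_run p g r h mu Lg eps0 delta0 alpha0 b x z eps delta alpha ->
  stationary (reduced_objective g r h) bstar ->
  b @ \oo --> bstar ->
  minimizers (h ^~ bstar) = [set xhat h bstar] /\
  x @ \oo --> xhat h bstar.
Proof.
move=> _ _ _ gb rb dh dG _ cG _ mustar0 muP hmu _ [_ _ Lg0 _] _ _ _ _ a0 run _.
move=> bcvg.
have mu0 c : 0 < mu c by have /andP[+ _] := muP c; exact: lt_le_trans.
have mono c y y' : mu c * `|y - y'| ^+ 2 <=
    inner (grad_x h y c - grad_x h y' c) (y - y').
  apply: strongly_monotone => [u|u v]; first exact: dG.
  by have := hmu u c v; rewrite innerZl inner_norm.
have minE : minimizers (h ^~ bstar) = [set xhat h bstar].
  exact: strongly_convex_minimizers (mu0 bstar) (dh ^~ bstar) (mono bstar).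
split=> //; set xs := xhat h bstar.
have xs0 : grad_x h xs bstar = 0.
  apply: grad_minimizer => [y|]; first exact: dh.
  by rewrite minE.
(* Strong monotonicity at parameter [b k] and Cauchy-Schwarz, divided by [|xs - x k|]; hence the
   separate case [xs = x k]. The gradient at [x k] is bounded by the residual test. *)
have dist k : `|xs - x k| <= eps k + `|grad_x h xs (b k)| / mustar.
  have [->|/negPf xk] := eqVneq xs (x k).
    rewrite subrr normr0 addr_ge0 ?divr_ge0 ?(ltW mustar0)//.
    exact: (maid_run_accuracy_ge0 run).
  have n0 : 0 < `|xs - x k| by rewrite normr_gt0 subr_eq0 xk.
  have mub := mu0 (b k).
  have := le_trans (mono (b k) xs (x k)) (inner_le_norm _ _).
  rewrite expr2 mulrA ler_pM2r// => /le_trans/(_ (ler_normB _ _)) H1.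
  have H2 := maid_run_inexact run k.
  rewrite -(ler_pM2l mub) mulrDr (le_trans H1)// addrC lerD//.
    by rewrite mulrC.
  (* The factor [mu (b k) / mustar] is at least 1. *)
  rewrite mulrCA ler_peMr// ler_pdivlMr// mul1r.
  by have /andP[] := muP (b k).
have bnd : eps k + `|grad_x h xs (b k)| / mustar @[k --> \oo] --> (0 : R).
  rewrite -[X in _ --> X](addr0 0); apply: cvgD.
    exact: maid_run_accuracy_cvg0 run Lg0 a0 mu0 gb rb.
  rewrite -(mul0r mustar^-1); apply: cvgM; last exact: cvg_cst.
  (* The first argument stays fixed at [xs], so continuity of [grad_x h xs] in [b] gives the
     limit. *)
  rewrite -(normr0 X) -xs0; apply: cvg_norm.
  by apply: cvg_comp bcvg _; exact: cG.
apply/cvgrPdist_le => e e0.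
move/cvgr0Pnorm_le : bnd => /(_ _ e0); apply: filterS => k bk.
exact: le_trans (dist k) (le_trans (ler_norm _) bk).
Qed.
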